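(* Let $n\ge 3$ and let $\mathcal{C}$ be a maximal (by inclusion) collection of pairwise weakly separated $3$-subsets of $[1\dots n]$. Then $|\mathcal{C}|=3(n-3)+1$.
   Context: Notation: $[1\dots n]=\{1,\dots,n\}$; $X-Y$ is set difference. For sets of integers write $X\prec Y$ if $x<y$ for all $x\in X$, $y\in Y$ (vacuously true if one is empty). Two $k$-subsets $I,J$ of $[1\dots n]$ are weakly separated if at least one of the following holds: (1) $J-I$ can be partitioned as $J'\sqcup J''$ with $J'\prec I-J\prec J''$; (2) $I-J$ can be partitioned as $I'\sqcup I''$ with $I'\prec J-I\prec I''$. (Parts may be empty.) *)

(* Defs.v *)
From mathcomp Require Import all_boot.

Set Implicit Arguments.
Unset Strict Implicit.
Unset Printing Implicit Defensive.

(* The ground set [1...n] is represented by 'I_n = {0, ..., n-1}, through the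
   order isomorphism i |-> i - 1: only the linear order of the integers 1, ..., n
   is used. *)

Definition prec (n : nat) (X Y : {set 'I_n}) : bool :=
  [forall x in X, forall y in Y, x < y].

(* finset's [partition] is not usable here, since it excludes empty blocks. *)
Definition surrounds (n : nat) (B A : {set 'I_n}) : bool :=
  [exists B1 : {set 'I_n}, exists B2 : {set 'I_n},
    [&& B1 :|: B2 == B, [disjoint B1 & B2], prec B1 A & prec A B2]].

(* Only meant for sets of the same cardinality: for sets of different sizes,
   weak separation carries an additional condition. *)
Definition weakly_separated (n : nat) (I J : {set 'I_n}) : bool :=
  surrounds (J :\: I) (I :\: J) || surrounds (I :\: J) (J :\: I).

(* The case I = J is harmless: every set is weakly separated from itself. *)
Definition ws_collection (n k : nat) (C : {set {set 'I_n}}) : bool :=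
  [forall I in C, #|I| == k] &&
  [forall I in C, forall J in C, weakly_separated I J].

(* Main.v *)
Require Import Defs.
From mathcomp Require Import all_boot zify.

(** The proof is an induction on n that deletes the largest element m of
    {0, ..., m}.  Weak separation only depends on the cyclic order, in which m
    and 0 are neighbours, so m can be pushed onto 0: a triple {a, b, m} becomes
    {0, a, b}, except that {0, c, m}, where 0 is already present, becomes
    {0, 1, c}, or {0, 1, 2} if c = 1.  This map, [shrink], sends a maximal
    collection on {0, ..., m} to a maximal collection on {0, ..., m - 1}
    ([wsmax_shrink]) and the image has exactly three triples less
    ([count_shrink]).

    To see this, view the triples of a maximal collection C that meet {0, m} as
    three kinds of objects on the points 1, ..., m - 1: a lower edge xy stands
    for {0, x, y}, an upper edge xy for {x, y, m}, and a hub z for {0, z, m}.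
    Weak separation says that all edges are pairwise noncrossing, that no hub
    lies strictly under an edge, and that every lower edge is componentwise at
    most every upper edge.  By the last condition at most one edge is both lower
    and upper.  The heart of the proof is that maximality provides such a shared
    edge ([ex_shared]): the lower edges have a greatest element, because
    otherwise a lower edge could be added, and that element can then be added to
    the upper edges.  The shared edge uw controls everything else:
    - one of u, w is a hub ([shared_endpoint]);
    - therefore two consecutive hubs are joined by an edge ([consecutive]);
    - if w > u + 1, then some {u, z, w} with u < z < w is in C
      ([shared_third]).
    Three coincidences account for the loss: {0, 1, 2} and {0, 1, m}, both always
    in C, have the same image; so have the two triples of the shared edge; and if
    d is the hub after the hub 1, then 1d is an edge and its image {0, 1, d} is
    also that of the hub d.  The image of C is maximal because, by the
    consequences of the shared edge, a triple compatible with it is the image of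
    a triple compatible with C.

    Every step compares a few triples, and weak separation of triples depends
    on nothing but the relative order of their entries.  Such finite checks are
    left to the tactic [order], which enumerates the possible relative orders.
    All arguments are carried out on predicates over triples of numbers; the
    last part transfers the result to sets of sets. *)

Set Implicit Arguments.
Unset Strict Implicit.
Unset Printing Implicit Defensive.

(** * Weak separation of triples of natural numbers *)

(** The negation of [straddles I J] says that J - I splits into a part before
    I - J and a part after it. *)
Definition straddles (I J : seq nat) : bool :=
  has (fun s => [&& s \notin I, has (fun i => (i \notin J) && (i < s)) I
                  & has (fun i => (i \notin J) && (s < i)) I]) J.

Definition ws (a b c x y z : nat) : bool :=
  ~~ (straddles [:: a; b; c] [:: x; y; z] &&
      straddles [:: x; y; z] [:: a; b; c]).

(** * Deciding statements about the relative order of finitely many numbers *)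

(** Formulas about the order of the entries of a list, which are referred to by
    their index. *)
Inductive form :=
  | Lt of nat & nat | Le of nat & nat | Eq of nat & nat
  | Ws of nat & nat & nat & nat & nat & nat
  | Neg of form | And of form & form | Or of form & form | Imp of form & form.

Fixpoint eval (e : seq nat) (f : form) : bool :=
  match f with
  | Lt i j => nth 0 e i < nth 0 e j
  | Le i j => nth 0 e i <= nth 0 e j
  | Eq i j => nth 0 e i == nth 0 e j
  | Ws a b c x y z => ws (nth 0 e a) (nth 0 e b) (nth 0 e c)
                         (nth 0 e x) (nth 0 e y) (nth 0 e z)
  | Neg f => ~~ eval e f
  | And f g => eval e f && eval e g
  | Or f g => eval e f || eval e g
  | Imp f g => eval e f ==> eval e g
  end.

Definition oneg : option bool -> option bool := omap negb.

Definition oand (u v : option bool) : option bool :=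
  match u, v with
  | Some false, _ | _, Some false => Some false
  | Some true, Some true => Some true
  | _, _ => None
  end.

Definition oor u v := oneg (oand (oneg u) (oneg v)).

Definition guard (l s : seq nat) (b : bool) : option bool :=
  if all (fun i => i < size l) s then Some b else None.

(** Three-valued evaluation on a list [l] that may be too short for [f]: the
    answer [None] means that the entries of [l] do not determine the truth
    value. *)
Fixpoint peval (l : seq nat) (f : form) : option bool :=
  match f with
  | Lt i j => guard l [:: i; j] (nth 0 l i < nth 0 l j)
  | Le i j => guard l [:: i; j] (nth 0 l i <= nth 0 l j)
  | Eq i j => guard l [:: i; j] (nth 0 l i == nth 0 l j)
  | Ws a b c x y z => guard l [:: a; b; c; x; y; z]
      (ws (nth 0 l a) (nth 0 l b) (nth 0 l c)
          (nth 0 l x) (nth 0 l y) (nth 0 l z))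
  | Neg f => oneg (peval l f)
  | And f g => oand (peval l f) (peval l g)
  | Or f g => oor (peval l f) (peval l g)
  | Imp f g => oor (oneg (peval l f)) (peval l g)
  end.

(** Depth-first search for an order of [size l + n] entries that satisfies [fs].
    The list [l] gives the ranks, among [0, ..., k - 1], of the entries placed so
    far; the next entry either shares a rank [h] with an earlier one or takes a
    new rank [h], which moves the ranks from [h] on up by one.  A branch is
    abandoned as soon as one formula is false, and formulas known to be true are
    dropped.  The outer conditional, in place of a disjunction, keeps
    call-by-value evaluation from searching below an abandoned node. *)
Fixpoint refuted (n : nat) (l : seq nat) (k : nat) (fs : seq form) : bool :=
  if has (fun f => peval l f == Some false) fs then true else
  if n is n'.+1 then
    let fs' := [seq f <- fs | peval l f != Some true] in
    all (fun h => refuted n' (rcons l h) k fs') (iota 0 k) &&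
    all (fun h => refuted n' (rcons [seq (h <= i) + i | i <- l] h) k.+1 fs')
        (rcons (iota 0 k) k)
  else false.

Definition agrees (u : option bool) (b : bool) : Prop :=
  forall c, u = Some c -> b = c.

Lemma agrees_neg u b : agrees u b -> agrees (oneg u) (~~ b).
Proof. by case: u => // c /(_ c erefl) -> _ [<-]. Qed.

Lemma agrees_and u v b c : agrees u b -> agrees v c -> agrees (oand u v) (b && c).
Proof.
by case: u => [[]|] hu; case: v => [[]|] hv ? //= [<-];
   rewrite ?(hu _ erefl) ?(hv _ erefl) ?andbF.
Qed.

Lemma agrees_or u v b c : agrees u b -> agrees v c -> agrees (oor u v) (b || c).
Proof.
move=> hu hv; rewrite -[b || c]negbK negb_or.
by apply: agrees_neg; apply: agrees_and; apply: agrees_neg.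
Qed.

Lemma agrees_guard l s b c :
  (all (fun i => i < size l) s -> b = c) -> agrees (guard l s b) c.
Proof. by rewrite /guard; case: ifP => // _ /(_ isT) -> _ [<-]. Qed.

Definition same_order (l e : seq nat) : Prop :=
  forall i j, i < size l -> j < size l ->
    (nth 0 l i < nth 0 l j) = (nth 0 e i < nth 0 e j).

Section SameOrder.

Variables l e : seq nat.
Hypothesis so : same_order l e.

Lemma same_order_le i j : i < size l -> j < size l ->
  (nth 0 l i <= nth 0 l j) = (nth 0 e i <= nth 0 e j).
Proof. by move=> il jl; rewrite leqNgt so // -leqNgt. Qed.

Lemma same_order_eq i j : i < size l -> j < size l ->
  (nth 0 l i == nth 0 l j) = (nth 0 e i == nth 0 e j).
Proof. by move=> il jl; rewrite !eqn_leq !same_order_le. Qed.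

Lemma same_order_mem i s : i < size l -> all (fun j => j < size l) s ->
  (nth 0 l i \in map (nth 0 l) s) = (nth 0 e i \in map (nth 0 e) s).
Proof.
move=> il; elim: s => //= j s IH /andP[jl sl].
by rewrite !inE same_order_eq // IH.
Qed.

Lemma same_order_straddles I J :
  all (fun j => j < size l) I -> all (fun j => j < size l) J ->
  straddles (map (nth 0 l) I) (map (nth 0 l) J) =
  straddles (map (nth 0 e) I) (map (nth 0 e) J).
Proof.
move=> Il Jl; rewrite /straddles !has_map; apply: eq_in_has => s sJ /=.
have sl : s < size l by move/allP: Jl; apply.
rewrite same_order_mem // !has_map.
by congr [&& _, _ & _]; apply: eq_in_has => i iI /=;
   have il : i < size l by [move/allP: Il; apply]; rewrite same_order_mem ?so.
Qed.

Lemma same_order_ws a b c x y z :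
  all (fun i => i < size l) [:: a; b; c; x; y; z] ->
  ws (nth 0 l a) (nth 0 l b) (nth 0 l c) (nth 0 l x) (nth 0 l y) (nth 0 l z) =
  ws (nth 0 e a) (nth 0 e b) (nth 0 e c) (nth 0 e x) (nth 0 e y) (nth 0 e z).
Proof.
rewrite (all_cat _ [:: a; b; c] [:: x; y; z]) => /andP[Il Jl].
have := same_order_straddles Il Jl; have := same_order_straddles Jl Il.
by rewrite /ws [map _ _]/= => /= -> ->.
Qed.

Lemma peval_sound f : agrees (peval l f) (eval e f).
Proof.
elim: f => [i j|i j|i j|a b c x y z|f IHf|f IHf g IHg|f IHf g IHg|f IHf g IHg] /=.
- by apply: agrees_guard => /= /and3P[? ? _]; apply: so.
- by apply: agrees_guard => /= /and3P[? ? _]; apply: same_order_le.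
- by apply: agrees_guard => /= /and3P[? ? _]; apply: same_order_eq.
- by apply: agrees_guard; apply: same_order_ws.
- exact: agrees_neg.
- exact: agrees_and.
- exact: agrees_or.
by rewrite implybE; apply: agrees_or => //; apply: agrees_neg.
Qed.

End SameOrder.

(** If [l] has the order type of the first entries of [e], then one of the
    branches explored by [refuted] has the order type of one more entry: the next
    entry of [e] equals an earlier one, or it is new and its rank is one more
    than the largest rank of a smaller entry. *)
Lemma refuted_sound n l k fs e :
  size e = size l + n -> same_order l e -> all (fun x => x < k) l ->
  refuted n l k fs -> ~~ all (eval e) fs.
Proof.
have dead fs' m : has (fun f => peval m f == Some false) fs' ->
    same_order m e -> ~~ all (eval e) fs'.
  move=> h so; rewrite -has_predC; apply: sub_has h => f /eqP h /=.
  by rewrite (peval_sound so h).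
elim: n l k fs => [|n IH] l k fs sz so lk.
  by rewrite /=; case: ifP => // /dead h _; apply: h.
rewrite [refuted _ _ _ _]/=; case: ifP => [/dead h _|_]; first exact: h.
set v := nth 0 e (size l).
set fs' := filter _ fs; case/andP=> /allP hj /allP hn.
suff: ~~ all (eval e) fs'.
  by apply: contra; rewrite all_filter; apply: sub_all => f ef /=; apply/implyP.
have [/hasP[i]|/hasPn nv] := boolP (has (fun i => nth 0 e i == v) (iota 0 (size l))).
  rewrite mem_iota /= add0n => il /eqP iv.
  have ik : nth 0 l i < k by move/all_nthP: lk; apply.
  apply: (IH (rcons l (nth 0 l i)) k); last by apply: hj; rewrite mem_iota.
  - by rewrite size_rcons addSnnS.
  - pose r c := if c < size l then c else i.
    have rl c : r c < size l by rewrite /r; case: ifP.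
    have ext c : c <= size l ->
        nth 0 (rcons l (nth 0 l i)) c = nth 0 l (r c) /\
        nth 0 e c = nth 0 e (r c).
      rewrite nth_rcons /r leq_eqVlt => /orP[/eqP->|->] //.
      by rewrite ltnn eqxx iv.
    move=> a b; rewrite size_rcons !ltnS => /ext[-> ->] /ext[-> ->].
    exact: so.
  - by rewrite all_rcons ik.
pose h := \max_(i <- iota 0 (size l) | nth 0 e i < v) (nth 0 l i).+1.
have hlt i : i < size l -> (nth 0 l i < h) = (nth 0 e i < v).
  move=> il; apply/idP/idP=> [|iv]; last first.
    by apply: (leq_bigmax_seq (F := fun i => (nth 0 l i).+1));
       rewrite ?mem_iota.
  apply: contraLR; rewrite -leqNgt => vi; rewrite -leqNgt.
  apply/bigmax_leqP_seq=> j; rewrite mem_iota /= add0n => jl jv.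
  by rewrite so //; apply: leq_trans jv vi.
have hk : h <= k.
  apply/bigmax_leqP_seq=> j; rewrite mem_iota /= add0n => jl _.
  by move/all_nthP: lk; apply.
have nev i : i < size l -> (v < nth 0 e i) = ~~ (nth 0 e i < v).
  by move=> il; have := nv i; rewrite mem_iota /= add0n il => /(_ isT); lia.
apply: (IH (rcons [seq (h <= i) + i | i <- l] h) k.+1); last first.
- by apply: hn; rewrite mem_rcons inE mem_iota -leq_eqVlt.
- rewrite all_rcons ltnS hk /= all_map; apply: sub_all lk => x /=.
  by case: (h <= x) => /=; lia.
- move=> i j; rewrite size_rcons size_map !ltnS !nth_rcons size_map.
  case: (ltnP i (size l)) => il; case: (ltnP j (size l)) => jl il' jl'.
  + rewrite !(nth_map 0) // -so //; case: leqP; case: leqP; lia.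
  + have -> : j = size l by lia.
    rewrite eqxx (nth_map 0) // -/v -hlt //; case: leqP; lia.
  + have -> : i = size l by lia.
    rewrite eqxx (nth_map 0) // -/v nev // -hlt //; case: leqP; lia.
  + have [-> ->] : i = size l /\ j = size l by lia.
    by rewrite eqxx !ltnn.
by rewrite size_rcons size_map addSnnS.
Qed.

Lemma order_refutation e fs : refuted (size e) [::] 0 fs -> ~~ all (eval e) fs.
Proof. exact: refuted_sound. Qed.

(** [order vs] proves a goal [p1 -> ... -> pk -> q], with [q] possibly [False],
    whose formulas are Boolean combinations of comparisons and of instances of
    [ws] on the entries of [vs].  Entries are placed in the order of [vs], so the
    search is short when the most constrained ones come first.  The numerals in
    [vs] are as opaque as the variables: what relates 0 or 1 to the other entries
    has to be among the premises. *)
Ltac index x vs :=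
  lazymatch vs with
  | x :: _ => constr:(0)
  | _ :: ?vs => let i := index x vs in constr:(S i)
  end.

Ltac reify vs t :=
  lazymatch t with
  | ~~ ?p => let f := reify vs p in constr:(Neg f)
  | ?p && ?q => let f := reify vs p in let g := reify vs q in constr:(And f g)
  | ?p || ?q => let f := reify vs p in let g := reify vs q in constr:(Or f g)
  | ?p ==> ?q => let f := reify vs p in let g := reify vs q in constr:(Imp f g)
  | ws ?a ?b ?c ?x ?y ?z =>
      let a := index a vs in let b := index b vs in let c := index c vs in
      let x := index x vs in let y := index y vs in let z := index z vs in
      constr:(Ws a b c x y z)
  | leq (S ?x) ?y => let i := index x vs in let j := index y vs in constr:(Lt i j)
  | leq ?x ?y => let i := index x vs in let j := index y vs in constr:(Le i j)
  | eq_op ?x ?y => let i := index x vs in let j := index y vs in constr:(Eq i j)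
  end.

Ltac order_refute vs fs pf :=
  lazymatch goal with
  | |- is_true false =>
      exact (False_ind _
        (elimN idP (@order_refutation vs fs ltac:(vm_compute; reflexivity)) pf))
  | |- is_true ?p -> _ =>
      let f := reify vs p in
      let H := fresh in
      intro H; order_refute vs constr:(f :: fs)
        constr:(introT andP (conj (H : is_true (eval vs f)) pf)
                : is_true (all (eval vs) (f :: fs)))
  | |- False => suff: is_true false by []; order_refute vs fs pf
  | |- is_true ?p => apply: contraT; order_refute vs fs pf
  end.

Tactic Notation "order" constr(vs) :=
  order_refute vs (@nil form) (isT : is_true (all (eval vs) [::])).

(** * Maximal collections *)

(** Maximality of a collection of pairwise weakly separated triples, as the
    statement that the members are exactly the triples weakly separated from all
    members. *)
Definition wsmax (n : nat) (P : nat -> nat -> nat -> bool) : Prop :=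
  forall a b c, P a b c <->
    [/\ a < b, b < c, c < n & forall x y z, P x y z -> ws a b c x y z].

(** In comments, the triples of [P] that meet [{0, m}] are named after what they
    are on the points strictly between 0 and [m]: [P 0 x y] with [y < m] is a
    lower edge [xy], [P x y m] with [0 < x] an upper edge [xy], and [P 0 z m] a
    hub [z]. *)
Section Removal.

Variables (m : nat) (P : nat -> nat -> nat -> bool).
Hypotheses (m_gt2 : 2 < m) (maxP : wsmax m.+1 P).

(** The trivial bound is there because [order] treats 0 as any other entry. *)
Lemma P_range a b c : P a b c -> [/\ 0 <= a, a < b, b < c & c <= m].
Proof. by case/maxP. Qed.

Lemma P_ws a b c x y z : P a b c -> P x y z -> ws a b c x y z.
Proof. by case/maxP=> _ _ _; apply. Qed.

Lemma P_mem a b c : a < b -> b < c -> c <= m ->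
  (forall x y z, 0 <= x -> x < y -> y < z -> z <= m -> P x y z ->
    ws a b c x y z) -> P a b c.
Proof.
move=> ab bc cm h; apply/maxP; split=> // x y z Pxyz.
by have [? ? ? ?] := P_range Pxyz; apply: h.
Qed.

(** Cyclic intervals are weakly separated from every triple, hence belong to
    every maximal collection. *)
Lemma P_01m : P 0 1 m.
Proof.
(* A variable for 1 keeps [1 <= x] apart from its unfolding [0 < x] in [order]. *)
have [e e1] : exists e, e = 1 by exists 1.
rewrite -e1; apply: P_mem; try lia; move=> a b c a0 ab bc cm _.
have h x : (x <= 0) || (e <= x) by lia.
have [e0 em] : 0 < e /\ e < m by lia.
move: (h a) (h b) (h c) e0 em a0 ab bc cm; order [:: 0; e; m; a; b; c].
Qed.

Lemma P_012 : P 0 1 2.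
Proof.
have [e e1] : exists e, e = 1 by exists 1.
have [d d2] : exists d, d = 2 by exists 2.
rewrite -d2 -e1; apply: P_mem; try lia; move=> a b c a0 ab bc cm _.
have h x : [|| x <= 0, x == e | d <= x] by lia.
have [e0 ed] : 0 < e /\ e < d by lia.
move: (h a) (h b) (h c) e0 ed a0 ab bc cm; order [:: 0; e; d; m; a; b; c].
Qed.

Lemma P_0Pm : P 0 m.-1 m.
Proof.
have [e e1] : exists e, e = m.-1 by exists m.-1.
rewrite -e1; apply: P_mem; try lia; move=> a b c a0 ab bc cm _.
have h x : (x <= e) || (m <= x) by lia.
have [e0 em] : 0 < e /\ e < m by lia.
move: (h a) (h b) (h c) e0 em a0 ab bc cm; order [:: 0; e; m; a; b; c].
Qed.

(** The lower edges have a greatest element.  Let [x] be the largest left end of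
    a lower edge, and [xt] the longest lower edge from it.  If a lower edge
    reaches beyond [t], let [z] be the smallest right end of such an edge [p'z];
    it surrounds [xt].  Neither [xz] nor [tz] is a lower edge, by the choice of
    [t] and of [x], so each is blocked by a member of the collection; but a
    triple blocking the one is never weakly separated from a triple blocking the
    other.  So [xt] is the greatest lower edge.  Whatever could block it as an
    upper edge either blocks it as a lower edge or is a lower edge not below it,
    so it is an upper edge too. *)
Lemma ex_shared : exists u w, P 0 u w /\ P u w m.
Proof.
have [x Px xmax] : exists2 x, exists2 t, t < m & P 0 x t &
    forall p r, P 0 p r -> r < m -> p <= x.
  pose Q x := [exists t : 'I_m, P 0 x t].
  have exQ : exists x, Q x by exists 1; apply/existsP; exists (Ordinal m_gt2); exact: P_012.
  have bQ x : Q x -> x <= m.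
    by case/existsP=> t /P_range[] *; lia.
  case: (ex_maxnP exQ bQ) => x /existsP[t Pt] xmax; exists x; first by exists t.
  by move=> p r Ppr rm; apply: xmax; apply/existsP; exists (Ordinal rm).
have [t [tm Pxt tmax]] : exists t, [/\ t < m, P 0 x t & forall r, P 0 x r -> r < m -> r <= t].
  pose Q t := (t < m) && P 0 x t.
  have exQ : exists t, Q t by case: Px => t tm Pt; exists t; rewrite /Q tm.
  have bQ t : Q t -> t <= m by case/andP; lia.
  case: (ex_maxnP exQ bQ) => t /andP[tm Pt] tmax; exists t; split=> // r Pr rm.
  by apply: tmax; rewrite /Q rm.
have [_ x0 xt _] := P_range Pxt.
have rmax p r : P 0 p r -> r < m -> r <= t.
  move=> Ppr rm; case: leqP => // tr.
  pose Q z := [&& t < z, z < m & [exists p : 'I_m, P 0 p z]].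
  have exQ : exists z, Q z.
    have pm : p < m by case/P_range: Ppr; lia.
    by exists r; rewrite /Q tr rm; apply/existsP; exists (Ordinal pm).
  case: (ex_minnP exQ) => z /and3P[tz zm /existsP[[p' /= p'm] Pz]] zmin {p r Ppr rm tr}.
  have [_ p0 pz _] := P_range Pz.
  have px : p' < x.
    by rewrite ltn_neqAle (xmax _ _ Pz zm) andbT; apply: contraTneq tz => ep;
       rewrite -leqNgt tmax // -ep.
  have nxz : ~~ P 0 x z.
    by apply: contraL tz => h; rewrite -leqNgt tmax.
  have ntz : ~~ P 0 t z.
    by apply: contraL xt => h; rewrite -leqNgt (xmax t z).
  have key a b c : P a b c -> [&& (a == 0) ==> ((c < m) ==> (b <= x)),
     (a == 0) ==> ((b == x) ==> ((c < m) ==> (c <= t))),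
     (a == 0) ==> ((t < c) ==> ((c < m) ==> (z <= c))), ws a b c 0 x t & ws a b c 0 p' z].
    move=> PJ; rewrite !(P_ws PJ) ?andbT //; apply/and3P; split.
    - by apply/implyP=> /eqP a0; apply/implyP=> cm; apply: (xmax _ c) => //; rewrite -a0.
    - apply/implyP=> /eqP a0; apply/implyP=> /eqP bx; apply/implyP=> cm.
      by apply: tmax => //; rewrite -a0 -bx.
    apply/implyP=> /eqP a0; apply/implyP=> tc; apply/implyP=> cm.
    apply: zmin; rewrite /Q tc cm /=; subst a; have [_ _ bc _] := P_range PJ.
    by apply/existsP; exists (Ordinal (ltn_trans bc cm)).
  (* A triple that blocks [xz] rules out all triples that block [tz]. *)
  case/negP: nxz; apply: P_mem; try lia.
  move=> a b c a0 ab bc cm PJ; apply: contraT => bad.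
  case/negP: ntz; apply: P_mem; try lia.
  move=> a' b' c' a0' ab' bc' cm' PJ'.
  move: (key _ _ _ PJ) (key _ _ _ PJ') (P_ws PJ PJ').
  move: p0 px x0 xt tz zm a0 ab bc cm a0' ab' bc' cm' bad; clear.
  order [:: 0; p'; x; t; z; m; a; b; c; a'; b'; c'].
exists x, t; split=> //; apply: P_mem => // a b c a0 ab bc cm PJ.
have : (a == 0) ==> ((c < m) ==> ((b <= x) && (c <= t))).
  apply/implyP=> /eqP a0'; apply/implyP=> cm'; rewrite a0' in PJ.
  by rewrite (xmax _ _ PJ cm') (rmax _ _ PJ cm').
move: (P_ws PJ Pxt) x0 xt tm a0 ab bc cm; clear.
order [:: 0; x; t; m; a; b; c].
Qed.

Section Shared.

Variables u w : nat.
Hypotheses (Au : P 0 u w) (Bu : P u w m).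

Let u_gt0 : 0 < u. Proof. by case/P_range: Au. Qed.
Let uw : u < w. Proof. by case/P_range: Au. Qed.
Let wm : w < m. Proof. by case/P_range: Bu. Qed.

(** A hub at [u] is blocked by a lower edge [xw] with [x < u] or a triple [abw]
    with [b < u]; a hub at [w] by an upper edge [uy] with [w < y] or a triple
    [ubc] with [w < b].  No blocker of the first sort is weakly separated from a
    blocker of the second. *)
Lemma shared_endpoint : P 0 u m || P 0 w m.
Proof.
apply: contraT; rewrite negb_or => /andP[nu nw].
case/negP: nu; apply: P_mem; try lia.
move=> a b c a0 ab bc cm PJ; apply: contraT => bad.
case/negP: nw; apply: P_mem; try lia.
move=> a' b' c' a0' ab' bc' cm' PJ'.
move: (P_ws PJ Au) (P_ws PJ Bu) (P_ws PJ' Au) (P_ws PJ' Bu) (P_ws PJ PJ').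
move: u_gt0 uw wm a0 ab bc cm a0' ab' bc' cm' bad; clear.
order [:: 0; u; w; m; a; b; c; a'; b'; c'].
Qed.

(** A triple weakly separated from both triples of the shared edge forbids some
    [z] in one of three ways: by a lower bound [z >= c], if it is [suc] with
    [s < u] and [c < w]; by an upper bound [z <= b], if it is [bwc] with [u < b]
    and [w < c]; or because [z] must not lie strictly between two consecutive
    entries.  If there are lower bounds, [z] is the largest of them, and the
    triple that provides it is weakly separated from all others; if there are
    none, [z = u + 1] is too small to be forbidden. *)
Lemma shared_third : u.+1 < w -> exists2 z, u < z < w & P u z w.
Proof.
move=> uw1.
pose Q z := (u < z < w) && [exists b : 'I_u, P b u z].
have [/hasP[z zin Qz]|/hasPn noQ] := boolP (has Q (iota 0 w)).
  have bQ z' : Q z' -> z' <= w by rewrite /Q; lia.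
  case: (ex_maxnP (ex_intro _ z Qz) bQ) => {zin Qz}z /andP[/andP[uz zw] /existsP[[s /= su] Pz]] zmax.
  exists z; first by rewrite uz.
  apply: P_mem; try lia; move=> a b c a0 ab bc cm PJ.
  have : (b == u) ==> ((c < w) ==> (c <= z)).
    apply/implyP=> /eqP bu; apply/implyP=> cw; apply: zmax; subst b.
    by rewrite /Q bc cw; apply/existsP; exists (Ordinal ab).
  move: (P_ws PJ Au) (P_ws PJ Bu) (P_ws PJ Pz) (leq0n s) su uz zw.
  move: u_gt0 uw wm a0 ab bc cm; clear.
  order [:: 0; s; u; z; w; m; a; b; c].
exists u.+1; first by rewrite uw1 leqnn.
apply: P_mem; try lia; move=> a b c a0 ab bc cm PJ.
have : (b == u) ==> (w <= c).
  apply/implyP=> /eqP bu; rewrite leqNgt; apply/negP=> cw; subst b.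
  have := noQ c; rewrite mem_iota /= add0n => /(_ cw); rewrite /Q bc cw /=.
  by case/existsP; exists (Ordinal ab).
have [z zu] : exists z, z = u.+1 by exists u.+1.
have h x : (x <= u) || (z <= x) by lia.
have uz : u < z by lia.
rewrite -zu in uw1 *; move: (h a) (h b) (h c) (P_ws PJ Au) (P_ws PJ Bu).
move: uz uw1 u_gt0 wm a0 ab bc cm; clear.
order [:: 0; u; z; w; m; a; b; c].
Qed.

End Shared.

(** A shared edge [uw] cannot have [p < u] and [w < q], as one of its ends is a
    hub.  If [q <= w], then every upper edge, being at least [uw], ends at [q] or
    beyond, and it does not have the hub [p] strictly under it, so it is at least
    [pq]: hence [pq] is a lower edge.  Symmetrically, [pq] is an upper edge if
    [u <= p]. *)
Lemma consecutive p q : p < q -> P 0 p m -> P 0 q m ->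
  (forall z, p < z -> z < q -> ~~ P 0 z m) -> P 0 p q || P p q m.
Proof.
move=> pq Dp Dq gap.
have [u [w [Au Bu]]] := ex_shared.
have [_ u0 uw _] := P_range Au; have [_ _ wm _] := P_range Bu.
have [_ p0 _ _] := P_range Dp; have [_ _ qm _] := P_range Dq.
have gapJ a b c : P a b c -> (a == 0) ==> ((c == m) ==> ((b <= p) || (q <= b))).
  move=> PJ; apply/implyP=> /eqP a0; apply/implyP=> /eqP cm; subst a c.
  by apply: contraLR PJ; rewrite negb_or -!ltnNge => /andP[pb bq]; apply: gap.
have : (u <= p) || (q <= w).
  case/orP: (shared_endpoint Au Bu) => /gapJ; rewrite !eqxx /=; first by lia.
  by lia.
case/orP=> side; [apply/orP; right|apply/orP; left];
  (apply: P_mem; try lia); move=> a b c a0 ab bc cm PJ;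
  move: (gapJ _ _ _ PJ) (P_ws PJ Au) (P_ws PJ Bu) (P_ws PJ Dp) (P_ws PJ Dq);
  move: side p0 pq qm u0 uw wm a0 ab bc cm; clear;
  order [:: 0; p; q; m; u; w; a; b; c].
Qed.

(** * Deleting the largest element *)

(** The image of [P] when [m] is pushed onto 0, and onto 1 where 0 is taken. The
    triple [{0, 1, m}] would have to go to [{0, 1, 2}], a member already by
    [P_012]. *)
Definition shrink a b c :=
  [&& a < b, b < c, c < m &
    P a b c || ((a == 0) && (P b c m || ((b == 1) && P 0 c m)))].

(** Gives the triple of [P] from which a triple of [shrink] arises, with the
    relation between them in the Boolean form that [order] reads. *)
Lemma shrinkP a b c : shrink a b c ->
  exists x y z, P x y z /\
    [|| [&& a == x, b == y & c == z], [&& a == 0, b == x, c == y & z == m]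
      | [&& a == 0, b == 1, x == 0, y == c & z == m]].
Proof.
case/and4P=> ab bc cm /orP[PJ|/andP[a0 /orP[PJ|/andP[b1 PJ]]]].
- by exists a, b, c; rewrite !eqxx.
- by exists b, c, m; rewrite a0 !eqxx orbT.
by exists 0, c, m; rewrite a0 b1 !eqxx !orbT.
Qed.

Lemma shrink_keep a b c : P a b c -> c < m -> shrink a b c.
Proof. by move=> PJ cm; rewrite /shrink PJ cm; have [_ -> ->] := P_range PJ. Qed.

Lemma shrink_move a b : 0 < a -> P a b m -> shrink 0 a b.
Proof. by move=> a0 PJ; rewrite /shrink PJ a0 orbT; have [_ -> ->] := P_range PJ. Qed.

Lemma shrink_fan a : 1 < a -> P 0 a m -> shrink 0 1 a.
Proof. by move=> a1 PJ; rewrite /shrink PJ a1 !orbT; have [_ _ ->] := P_range PJ. Qed.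

Lemma shrink_ws a b c x y z : shrink a b c -> shrink x y z -> ws a b c x y z.
Proof.
move=> I J; have /and4P[ab bc cm _] := I; have /and4P[xy yz zm _] := J.
case/shrinkP: I => a' [b' [c' [PI]]]; case/shrinkP: J => x' [y' [z' [PJ]]].
have [e e1] : exists e, e = 1 by exists 1.
have h t : (t <= 0) || (e <= t) by lia.
have e0 : 0 < e by lia.
have [_ ab' bc' cm'] := P_range PI; have [_ xy' yz' zm'] := P_range PJ.
rewrite -e1; move: e0 ab bc cm xy yz zm (leq0n a) (leq0n x) ab' bc' cm' xy' yz' zm'.
move: (P_ws PI PJ) (h a') (h b') (h x') (h y'); clear.
order [:: 0; e; m; a; b; c; a'; b'; c'; x; y; z; x'; y'; z'].
Qed.

Section Compatible.

Variables a b c : nat.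
Hypotheses (ab : a < b) (bc : b < c) (cm : c < m).
Hypothesis compat : forall x y z, shrink x y z -> ws a b c x y z.

(** In the Boolean form that [order] reads, with one conjunct for each way in
    which a triple of [P] can be moved. *)
Lemma compat_P x y z : P x y z ->
  [&& (z < m) ==> ws a b c x y z,
      (z == m) ==> ((0 < x) ==> ws a b c 0 x y)
    & (z == m) ==> ((x == 0) ==> ((1 < y) ==> ws a b c 0 1 y))].
Proof.
move=> PJ; apply/and3P; split; apply/implyP.
- by move=> zm; apply: compat; apply: shrink_keep.
- move=> /eqP zm; apply/implyP=> x0; subst z.
  by apply: compat; apply: shrink_move.
move=> /eqP zm; apply/implyP=> /eqP x0; apply/implyP=> y1; subst x z.
by apply: compat; apply: shrink_fan.
Qed.

Lemma compat_edge p q : P 0 p q || P p q m -> 0 < p -> q < m -> ws a b c 0 p q.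
Proof.
case/orP=> PJ p0 qm; apply: compat; first exact: shrink_keep.
exact: shrink_move.
Qed.

(** A triple without 0 and [m] is not moved, so it has to be compatible with [P]
    itself.  This could only fail for a hub [y] with [a = 1 < y < b], whose image
    [{0, 1, y}] shares 1 with the triple.  Let [d] be the last hub before [b] and
    [f] the next one.  As [d >= y > 1], the edge [df], which exists by
    [consecutive], is not compatible with [{1, b, c}]. *)
Lemma shrink_mem_pos : 0 < a -> shrink a b c.
Proof.
move=> a0; apply: shrink_keep => //; apply: P_mem => // [|x y z x0 xy yz zm PJ].
  exact: ltnW.
have [e e1] : exists e, e = 1 by exists 1.
have h t : (t <= 0) || (e <= t) by lia.
have e0 : 0 < e by lia.
apply: contraT => bad; have := compat_P PJ; rewrite -e1.
have [/and3P[/eqP x_0 ey /eqP z_m]|nD] := boolP [&& x == 0, e < y & z == m]; last first.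
  move: bad nD e0 a0 ab bc cm x0 xy yz zm (h a) (h x) (h y); clear.
  order [:: 0; e; m; a; b; c; x; y; z].
subst x z => wsy; have {wsy} wsy : ws a b c 0 e y
  by case/and3P: wsy => _ _; rewrite !eqxx ey.
have ynb : y < b.
  move: wsy bad e0 a0 ab bc cm (h a) ey yz; clear.
  order [:: 0; e; m; a; b; c; y].
have [d [Dd yd db dmax]] : exists d, [/\ P 0 d m, y <= d, d < b &
    forall r, d < r -> r < b -> ~~ P 0 r m].
  pose Q d := (d < b) && P 0 d m.
  have exQ : exists d, Q d by exists y; rewrite /Q ynb.
  have bQ d : Q d -> d <= b by case/andP; lia.
  case: (ex_maxnP exQ bQ) => d /andP[db Dd] dmax; exists d; split=> //.
    by apply: dmax; rewrite /Q ynb.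
  by move=> r dr rb; apply: contraL dr => Dr; rewrite -leqNgt dmax // /Q rb.
have [f [Df bf fmin]] : exists f, [/\ P 0 f m, b <= f &
    forall r, b <= r -> r < f -> ~~ P 0 r m].
  pose Q f := (b <= f) && P 0 f m.
  have exQ : exists f, Q f by exists m.-1; rewrite /Q P_0Pm andbT; lia.
  case: (ex_minnP exQ) => f /andP[bf Df] fmin; exists f; split=> //.
  by move=> r br rf; apply: contraL rf => Dr; rewrite -leqNgt fmin // /Q br.
have df : d < f by lia.
have gap r : d < r -> r < f -> ~~ P 0 r m.
  by move=> dr rf; case: (ltnP r b) => rb; [apply: dmax|apply: fmin].
have [_ _ fm _] := P_range Df.
have := compat_edge (consecutive df Dd Df gap).
have d0 : 0 < d by lia.
move=> /(_ d0 fm) wsdf.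
move: wsdf wsy bad d0 df fm bf db yd e0 a0 ab bc cm (h a) ey yz; clear.
order [:: 0; e; m; a; b; c; y; d; f].
Qed.

(** The edge [bc] has to be lower or upper, or [b = 1] and [c] a hub.  The last
    case occurs if there is a hub strictly between [b] and [c].  Otherwise [bc]
    does not strictly surround the shared edge [uw], one of whose ends is a hub,
    and it is not strictly surrounded by it, because of the triple of
    [shared_third].  So [bc] and [uw] are comparable; if [bc] is the greater, it
    is at least every lower edge and so is an upper edge; if it is the smaller,
    it is a lower edge. *)
Lemma shrink_mem_zero : a = 0 -> shrink a b c.
Proof.
move=> a0; apply: contraT => nS.
have [nA nB nD] : [/\ ~~ P 0 b c, ~~ P b c m & ~~ ((b == 1) && P 0 c m)].
  by move: nS; rewrite /shrink a0 eqxx -{1}a0 ab bc cm !negb_or => /and3P[].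
have b0 : 0 < b by lia.
have cm' : c <= m by lia.
have [e e1] : exists e, e = 1 by exists 1.
have h t : (t <= 0) || (e <= t) by lia.
have e0 : 0 < e by lia.
have compatJ x y z : P x y z -> [&& (z < m) ==> ws 0 b c x y z,
      (z == m) ==> ((0 < x) ==> ws 0 b c 0 x y)
    & (z == m) ==> ((x == 0) ==> ((e < y) ==> ws 0 b c 0 e y))].
  by move=> PJ; have := compat_P PJ; rewrite -e1 a0.
have gap z : P 0 z m -> b < z -> z < c -> false.
  move=> Dz bz zc.
  have [eb|be|be] := ltngtP e b; [|lia|].
    have := compatJ _ _ _ Dz.
    move: eb bz zc e0 cm; clear; order [:: 0; e; b; z; c; m].
  case/negP: nD; rewrite -be e1 /=; subst b.
  apply: P_mem => //; first lia.
  move=> x y t x0 xy yt tm PJ; move: (compatJ _ _ _ PJ) (P_ws PJ Dz) (h x).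
  rewrite -e1 in bz *; move: bz zc e0 cm x0 xy yt tm; clear.
  order [:: 0; e; z; c; m; x; y; t].
have [u [w [Au Bu]]] := ex_shared.
have [_ u0 uw _] := P_range Au; have [_ _ wm _] := P_range Bu.
have gapg : [|| (u <= b) || (c <= u) | (w <= b) || (c <= w)].
  by case/orP: (shared_endpoint Au Bu) => /gap; lia.
have nsurr : (b <= u) || (w <= c).
  rewrite leqNgt [w <= c]leqNgt -negb_and; apply/negP=> /andP[ub cw].
  have uw1 : u.+1 < w by lia.
  have [z /andP[uz zw] PJ] := shared_third Au Bu uw1.
  have := compatJ _ _ _ PJ; move: ub cw u0 uw bc uz zw wm cm; clear.
  order [:: 0; u; b; c; w; m; z; e].
have gapJ x y z : P x y z -> (x == 0) ==> ((z == m) ==> ((y <= b) || (c <= y))).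
  move=> PJ; apply/implyP=> /eqP x0; apply/implyP=> /eqP zm; subst x z.
  by have := gap _ PJ; lia.
have side : (u <= b) && (w <= c) || (b <= u) && (c <= w) by lia.
case/orP: side => side; [case/negP: nB | case/negP: nA];
  apply: P_mem => // x y z x0 xy yz zm PJ;
  move: (compatJ _ _ _ PJ) (compatJ _ _ _ Au) (gapJ _ _ _ PJ) (P_ws PJ Au) (P_ws PJ Bu);
  move: (h x) (h y) side b0 bc cm u0 uw wm x0 xy yz zm e0; clear;
  order [:: 0; e; b; c; m; u; w; x; y; z].
Qed.

End Compatible.

Lemma wsmax_shrink : wsmax m shrink.
Proof.
move=> a b c; split=> [S|[ab bc cm compat]].
  by have /and4P[? ? ? _] := S; split=> // x y z; apply: shrink_ws.
case: (posnP a) => a0; first exact: shrink_mem_zero.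
exact: shrink_mem_pos.
Qed.

(** * Counting the triples that are merged *)

Definition count_triples n (Q : nat -> nat -> nat -> bool) : nat :=
  \sum_(a < n) \sum_(b < n) \sum_(c < n) Q a b c.

Lemma sum_only (F : nat -> nat) i n : i < n ->
  (forall j, j < n -> j != i -> F j = 0) -> \sum_(j < n) F j = F i.
Proof.
move=> ln F0; rewrite (bigD1 (Ordinal ln)) //= big1 ?addn0 // => j ji.
exact: F0.
Qed.

Lemma sum2_unique (Q : nat -> nat -> bool) u w n : u < n -> w < n -> Q u w ->
  (forall b c, b < n -> c < n -> Q b c -> b = u /\ c = w) ->
  \sum_(b < n) \sum_(c < n) Q b c = 1.
Proof.
move=> un wn Quw uni; rewrite (sum_only (F := fun b => \sum_(c < n) Q b c) un).
  rewrite (sum_only (F := fun c => Q u c : nat) wn) ?Quw // => c cn.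
  by case Qc: (Q u c) => //; have [_ ->] := uni _ _ un cn Qc; rewrite eqxx.
move=> b bn bu; rewrite big1 // => c _.
by case Qc: (Q b c) => //; have [bE _] := uni _ _ bn (ltn_ord c) Qc; rewrite bE eqxx in bu.
Qed.

Lemma count_triples_last :
  count_triples m.+1 P = count_triples m P + \sum_(b < m) \sum_(c < m) P b c m.
Proof.
have P0 a b c : ~~ [&& a < b, b < c & c <= m] -> P a b c = false.
  by apply: contraNF => /P_range[_ -> -> ->].
rewrite /count_triples big_ord_recr /= [X in _ + X]big1 ?addn0; last first.
  by move=> b _; rewrite big1 // => c _; rewrite P0 //; lia.
rewrite -big_split /=; apply: eq_bigr => a _.
rewrite big_ord_recr /= [X in _ + X]big1 ?addn0; last first.
  by move=> c _; rewrite P0 //; have := ltn_ord c; lia.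
by rewrite -big_split /=; apply: eq_bigr => b _; rewrite big_ord_recr.
Qed.

Lemma sum_first n (F : nat -> nat) : 0 < n ->
  \sum_(b < n) F b = F 0 + \sum_(b < n) (0 < b) * F b.
Proof.
case: n => // n _; rewrite !big_ord_recl mul0n add0n.
by congr (_ + _); apply: eq_bigr => i _; rewrite mul1n.
Qed.

(** The triples of [shrink] outside [P] contain 0; they are recorded as edges. *)
Definition new_edge b c := shrink 0 b c && ~~ P 0 b c.

Lemma count_triples_shrink : count_triples m shrink =
  count_triples m P + \sum_(b < m) \sum_(c < m) new_edge b c.
Proof.
rewrite /count_triples.
have -> : \sum_(b < m) \sum_(c < m) new_edge b c =
    \sum_(a < m) (a == 0 :> nat) * \sum_(b < m) \sum_(c < m) new_edge b c.
  rewrite (sum_only (i := 0) (F := fun a =>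
    (a == 0) * \sum_(b < m) \sum_(c < m) new_edge b c)) ?mul1n //; first lia.
  by move=> j _ /negbTE ->.
rewrite -big_split /=; apply: eq_bigr => a _.
rewrite big_distrr -big_split /=; apply: eq_bigr => b _.
rewrite big_distrr -big_split /=; apply: eq_bigr => c _.
rewrite /new_edge /shrink ltn_ord.
case PJ: (P a b c).
  have [_ -> -> _] := P_range PJ; case: eqP => [a0|//].
  by have -> : P 0 b c by [rewrite -a0]; rewrite !andbF.
case: eqP => [a0|_]; last by rewrite !andbF.
have -> : P 0 b c = false by rewrite -a0.
by rewrite mul1n /= andbT add0n a0.
Qed.

(** The images of the hubs other than 1. *)
Definition fan_edge b c := [&& b == 1, 1 < c & P 0 c m].

Lemma sum_fan_edge :
  \sum_(b < m) P 0 b m = 1 + \sum_(b < m) \sum_(c < m) fan_edge b c.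
Proof.
rewrite (sum_only (F := fun b => \sum_(c < m) fan_edge b c) (i := 1)); first last.
- by move=> b _ /negbTE b1; rewrite big1 // => c _; rewrite /fan_edge b1.
- lia.
have one : \sum_(c < m) (c == 1 :> nat) = 1.
  rewrite (sum_only (F := fun c => c == 1 : nat) (i := 1)) //; first lia.
  by move=> j _ /negbTE ->.
rewrite -{1}one -big_split /=; apply: eq_bigr => c _; rewrite /fan_edge eqxx /=.
have [c1|c1|->] := ltngtP c 1; last by rewrite P_01m.
  by case PJ: (P 0 c m) => //; have [_] := P_range PJ; lia.
by rewrite add0n.
Qed.

(** Two shared edges would each be below the other. *)
Lemma sum_shared : \sum_(b < m) \sum_(c < m) (P 0 b c && P b c m) = 1.
Proof.
have [u [w [Au Bu]]] := ex_shared.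
have [_ u0 uw _] := P_range Au; have [_ _ wm _] := P_range Bu.
apply: (sum2_unique (u := u) (w := w) (Q := fun b c => P 0 b c && P b c m)) => //.
- exact: ltn_trans wm.
- by rewrite Au.
move=> b c bm cm /andP[Ab Bb].
have [_ b0 bc _] := P_range Ab.
suff : (b == u) && (c == w) by case/andP=> /eqP-> /eqP->.
move: (P_ws Ab Bu) (P_ws Au Bb) u0 uw wm b0 bc cm; clear.
order [:: 0; u; w; m; b; c].
Qed.

(** An edge [1c] has no hub strictly below it, so [c] is the second hub [d]; and
    [1d] is an edge because the hubs 1 and [d] are consecutive. *)
Lemma sum_fan_old :
  \sum_(b < m) \sum_(c < m) (fan_edge b c && (P 0 b c || P b c m)) = 1.
Proof.
have [d [d1 Dd dmin]] : exists d, [/\ 1 < d, P 0 d m &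
    forall z, 1 < z -> z < d -> ~~ P 0 z m].
  pose Q d := (1 < d) && P 0 d m.
  have exQ : exists d, Q d by exists m.-1; rewrite /Q P_0Pm andbT; lia.
  case: (ex_minnP exQ) => d /andP[d1 Dd] dmin; exists d; split=> // z z1 zd.
  by apply: contraL zd => Dz; rewrite -leqNgt dmin // /Q z1.
have e1d := consecutive d1 P_01m Dd dmin.
have [_ _ dm _] := P_range Dd.
apply: (sum2_unique (u := 1) (w := d)
  (Q := fun b c => fan_edge b c && (P 0 b c || P b c m))) => //.
- lia.
- by rewrite /fan_edge eqxx d1 Dd.
move=> b c bm cm /andP[/and3P[/eqP -> c1 Dc] e1c]; split=> //.
case: (ltngtP c d) => // [cd|dc]; first by case/negP: (dmin _ c1 cd).
have [e e1] : exists e, e = 1 by exists 1.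
have e0 : 0 < e by lia.
suff : false by [].
rewrite -e1 in d1 e1c *; case/orP: e1c => PJ;
  move: (P_ws Dd PJ) d1 dc cm e0; clear; order [:: 0; e; d; c; m].
Qed.

(** Inclusion and exclusion for the lower edges, the upper edges and the images
    of the hubs, whose union is the set of edges of [shrink].  The overlaps
    contribute 2, and the hub 1, which gives no fan edge, contributes 1. *)
Lemma count_shrink : count_triples m.+1 P = count_triples m shrink + 3.
Proof.
rewrite count_triples_last count_triples_shrink -addnA; congr (_ + _).
rewrite (sum_first (fun b => \sum_(c < m) P b c m)); last lia.
rewrite sum_fan_edge.
suff : \sum_(b < m) \sum_(c < m) fan_edge b c +
       \sum_(b < m) (0 < b) * \sum_(c < m) P b c m =
       \sum_(b < m) \sum_(c < m) new_edge b c +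
       (\sum_(b < m) \sum_(c < m) (P 0 b c && P b c m) +
        \sum_(b < m) \sum_(c < m) (fan_edge b c && (P 0 b c || P b c m))).
  by rewrite sum_shared sum_fan_old; lia.
rewrite -!big_split; apply: eq_bigr => b _ /=.
rewrite big_distrr -!big_split; apply: eq_bigr => c _ /=.
rewrite /new_edge /fan_edge /shrink /= ltn_ord.
have : P 0 b c -> 0 < b < c by case/P_range=> _ -> ->.
have : P b c m -> b < c by case/P_range.
case: (P 0 b c) (P b c m) (P 0 c m) => [] [] [];
  case: (nat_of_ord b) => [|[|?]] h1 h2; rewrite ?andbF ?andbT ?orbT ?orbF //=; lia.
Qed.

End Removal.

Theorem wsmax_count n P : 2 < n -> wsmax n P -> count_triples n P = 3 * (n - 3) + 1.
Proof.
elim: n P => // m IH P; rewrite ltnS leq_eqVlt => /orP[/eqP<-|m2] maxP.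
  have P012 : P 0 1 2.
    apply/maxP; split=> // x y z /maxP[xy yz z3 _].
    by have [-> -> ->] : [/\ x = 0, y = 1 & z = 2] by split; lia.
  have PF a b c : ~~ [&& a < b, b < c & c < 3] -> P a b c = false.
    by apply: contraNF => /maxP[-> -> ->].
  by rewrite /count_triples !big_ord_recl !big_ord0 /= /bump /= P012 !PF.
by rewrite (count_shrink m2 maxP) (IH _ m2 (wsmax_shrink m2 maxP)); lia.
Qed.

(** * From sets of ordinals to triples of numbers *)

Section Transfer.

Variable n : nat.
Implicit Types I J A B : {set 'I_n}.

Definition triple (a b c : nat) : {set 'I_n} :=
  [set i : 'I_n | (i : nat) \in [:: a; b; c]].

(** The first part of the splitting consists of the elements of [B] that precede
    all of [A]; disjointness makes the comparisons of the others strict. *)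
Lemma surroundsP A B : [disjoint A & B] -> surrounds B A =
  ~~ [exists s in B, [exists i in A, i < s] && [exists i in A, s < i]].
Proof.
move=> dAB; apply/idP/idP.
  case/existsP=> B1 /existsP[B2 /and4P[/eqP defB _ /forall_inP p1 /forall_inP p2]].
  apply/exists_inP=> -[s]; rewrite -defB in_setU => sB.
  case/andP=> /exists_inP[i iA ilt] /exists_inP[j jA jgt].
  case/orP: sB => sB.
    by have /forall_inP/(_ i iA) := p1 s sB; rewrite ltnNge (ltnW ilt).
  by have /forall_inP/(_ s sB) := p2 j jA; rewrite ltnNge (ltnW jgt).
move/exists_inPn=> h; apply/existsP.
exists [set s in B | [forall i in A, s < i]].
apply/existsP; exists [set s in B | ~~ [forall i in A, s < i]].
apply/and4P; split.
- by apply/eqP/setP=> s; rewrite !inE -andb_orr orbN andbT.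
- by rewrite -setI_eq0; apply/eqP/setP=> s; rewrite !inE; case: (s \in B) => //; rewrite andbN.
- by apply/forall_inP=> s; rewrite inE => /andP[].
apply/forall_inP=> i iA; apply/forall_inP=> s; rewrite inE => /andP[sB].
case/forall_inPn=> j jA; rewrite -leqNgt => js.
have neq k : k \in A -> (k : nat) != s.
  move=> kA; apply: contraTneq sB => /val_inj <-.
  by rewrite (disjointFr dAB kA).
have {}js : j < s by rewrite ltn_neqAle neq.
have := h s sB; rewrite negb_and => /orP[/exists_inPn/(_ j jA)|/exists_inPn/(_ i iA)].
  by rewrite js.
by rewrite -leqNgt => h'; rewrite ltn_neqAle neq.
Qed.

Definition in_range (s : seq nat) := all (fun i => i < n) s.

Lemma exists_triple (p : nat -> bool) a b c : in_range [:: a; b; c] ->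
  [exists i : 'I_n, ((i : nat) \in [:: a; b; c]) && p i] = has p [:: a; b; c].
Proof.
move=> /allP rg; apply/existsP/hasP=> [[i /andP[iI pi]]|[i iI pi]].
  by exists (i : nat).
by exists (Ordinal (rg i iI)); rewrite /= iI.
Qed.

Lemma surrounds_triple a b c x y z :
  in_range [:: a; b; c] -> in_range [:: x; y; z] ->
  surrounds (triple x y z :\: triple a b c) (triple a b c :\: triple x y z) =
  ~~ straddles [:: a; b; c] [:: x; y; z].
Proof.
move=> rI rJ; rewrite surroundsP; last first.
  by rewrite disjoint_sym disjoints_subset; apply/subsetP=> s; rewrite !in_setD in_setC in_setD negb_and negbK => /andP[_ ->].
congr (~~ _); rewrite /straddles -(exists_triple _ rJ).
apply: eq_existsb => s; rewrite !inE -!andbA; rewrite andbCA; congr (_ && _).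
congr (_ && _); congr (_ && _); rewrite -(exists_triple _ rI);
  by apply: eq_existsb => i; rewrite !inE -andbA andbCA.
Qed.

Lemma weakly_separated_triple a b c x y z :
  in_range [:: a; b; c] -> in_range [:: x; y; z] ->
  weakly_separated (triple a b c) (triple x y z) = ws a b c x y z.
Proof.
by move=> rI rJ; rewrite /weakly_separated !surrounds_triple // /ws negb_and.
Qed.

Lemma card_triple a b c : a < b -> b < c -> c < n -> #|triple a b c| = 3.
Proof.
move=> ab bc cn; have bn := ltn_trans bc cn; have an := ltn_trans ab bn.
have -> : triple a b c = [set Ordinal an; Ordinal bn; Ordinal cn].
  by apply/setP=> i; rewrite !inE -!val_eqE /= orbA.
by rewrite setUC cardsU1 cards2 !inE -!val_eqE /=; lia.
Qed.

Lemma triple_of_card I : #|I| = 3 ->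
  exists a b c, [/\ a < b, b < c, c < n & I = triple a b c].
Proof.
move=> I3; pose s := [seq val i | i <- enum I].
have s_sorted : sorted ltn s.
  rewrite /s; have : subseq s (map val (enum 'I_n)).
    by apply: map_subseq; rewrite enumT; apply: filter_subseq.
  by move/(subseq_sorted ltn_trans); apply; rewrite val_enum_ord iota_ltn_sorted.
have memI i : (i \in I) = ((i : nat) \in s).
  by rewrite /s mem_map ?mem_enum //; apply: val_inj.
have sn i : i \in s -> i < n by case/mapP=> j _ ->; apply: ltn_ord.
have : size s = 3 by rewrite -I3 cardE size_map.
clearbody s; case: s s_sorted memI sn => [|a [|b [|c []]]] //= /and3P[ab bc _] memI sn _.
exists a, b, c; split=> //; first by apply: sn; rewrite !inE eqxx !orbT.
by apply/setP=> i; rewrite memI in_set.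
Qed.

Lemma triple_inj a b c x y z : a < b -> b < c -> c < n ->
  x < y -> y < z -> z < n -> triple a b c = triple x y z ->
  [/\ a = x, b = y & c = z].
Proof.
move=> ab bc cn xy yz zn /setP eqT.
have mem i : i < n -> (i \in [:: a; b; c]) = (i \in [:: x; y; z]).
  by move=> lti; have := eqT (Ordinal lti); rewrite !inE.
have : (a \in [:: x; y; z]) && (b \in [:: x; y; z]) && (c \in [:: x; y; z]).
  by rewrite -!mem ?inE ?eqxx ?orbT //; lia.
by rewrite !inE => h; split; lia.
Qed.

Variable C : {set {set 'I_n}}.

Definition triples a b c := [&& a < b, b < c, c < n & triple a b c \in C].

Lemma wsmax_triples : maxset (@ws_collection n 3) C -> wsmax n triples.
Proof.
case/maxsetP=> /andP[/forall_inP C3 /forall_inP Cws] Cmax a b c; split.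
  move=> I; have /and4P[ab bc cn IC] := I; split=> // x y z /and4P[xy yz zn JC].
  rewrite -weakly_separated_triple; last 2 first.
  - by rewrite /in_range /=; lia.
  - by rewrite /in_range /=; lia.
  by have /forall_inP/(_ _ JC) := Cws _ IC.
case=> ab bc cn compat; rewrite /triples ab bc cn /=.
have wsC J : J \in C -> weakly_separated (triple a b c) J.
  move=> JC; have /eqP/triple_of_card[x [y [z [xy yz zn defJ]]]] := C3 J JC.
  rewrite defJ weakly_separated_triple /in_range /=; try lia.
  by apply: compat; rewrite /triples xy yz zn -defJ.
have wsC' J : J \in C -> weakly_separated J (triple a b c).
  by move=> /wsC; rewrite /weakly_separated orbC.
have wsT : weakly_separated (triple a b c) (triple a b c).
  by rewrite weakly_separated_triple /in_range /= /ws /straddles /= ?inE ?eqxx ?orbT //; lia.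
suff <- : triple a b c |: C = C by rewrite setU11.
apply: Cmax; last exact: subsetUr.
apply/andP; split; apply/forall_inP=> J; rewrite !inE => /orP[/eqP->|JC].
- by rewrite card_triple.
- exact: C3.
- by apply/forall_inP=> K; rewrite !inE => /orP[/eqP->|/wsC].
apply/forall_inP=> K; rewrite !inE => /orP[/eqP->|KC]; first exact: wsC'.
by have /forall_inP/(_ _ KC) := Cws _ JC.
Qed.

Lemma card_triples : {in C, forall I : {set 'I_n}, #|I| = 3} -> #|C| = count_triples n triples.
Proof.
move=> C3.
pose f (t : 'I_n * 'I_n * 'I_n) := triple t.1.1 t.1.2 t.2.
pose D := [set t : 'I_n * 'I_n * 'I_n | triples t.1.1 t.1.2 t.2].
have -> : C = f @: D.
  apply/setP=> I; apply/idP/imsetP=> [IC|[t]]; last first.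
    by rewrite inE => /and4P[_ _ _ h] ->.
  have [a [b [c [ab bc cn defI]]]] := triple_of_card (C3 I IC).
  have bn := ltn_trans bc cn; have an := ltn_trans ab bn.
  exists (Ordinal an, Ordinal bn, Ordinal cn) => //.
  by rewrite inE /triples /= ab bc cn -defI.
rewrite card_in_imset; last first.
  move=> [[a b] c] [[x y] z]; rewrite !inE /= => /and4P[ab bc cn _] /and4P[xy yz zn _].
  by rewrite /f /= => /triple_inj[] // /val_inj-> /val_inj-> /val_inj->.
rewrite /count_triples pair_big pair_big /= -sum1dep_card big_mkcond.
by apply: eq_bigr => t _; case: triples.
Qed.

End Transfer.

Theorem corollary2 (n : nat) (hn : 3 <= n) (C : {set {set 'I_n}})
  (hC : maxset (@ws_collection n 3) C) : #|C| = 3 * (n - 3) + 1.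
Proof.
rewrite card_triples; first by rewrite (wsmax_count hn (wsmax_triples hC)).
by move=> I IC; apply/eqP; case/maxsetP: hC => /andP[/forall_inP h _] _; apply: h.
Qed.
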